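(* Consider the system, defined for $w_1\neq0$, $$\begin{bmatrix}\dot w\\ \dot p\end{bmatrix}=\begin{bmatrix}0_n&Q_w\\ -Q_w^\top&C_w-D_w\end{bmatrix}\begin{bmatrix}\nabla_w\mathcal{H}_w\\ \nabla_p\mathcal{H}_w\end{bmatrix}+\begin{bmatrix}0_{n\times2}\\ G_w\end{bmatrix}u,\qquad \mathcal{H}_w=\tfrac12p^\top M_w^{-1}p+\mathcal{V}_w,$$ with $Q_w,C_w,D_w,G_w,M_w,\mathcal{V}_w$ as in the context, in closed loop with the control law $$u=-G_w^{-1}\left\{Q_w^\top\left[Lw-\nabla_w\mathcal{V}_w\right]+\left[\hat D+\frac{k}{w_1^2}Q_w^\top e_1e_1^\top Q_w\right]\nabla_p\mathcal{H}_w\right\},$$ where $\hat D\in\mathbb{R}^{2\times2}$ is positive definite, $e_1\in\mathbb{R}^n$ is the first standard basis vector, $k>0$ is a constant and $L=\operatorname{diag}(l_1,\dots,l_n)$ is a constant matrix with all $l_i>0$. The closed-loop dynamics have the form $$\begin{bmatrix}\dot w\\ \dot p\end{bmatrix}=\begin{bmatrix}0_n&Q_w\\ -Q_w^\top&C_w-D_d\end{bmatrix}\begin{bmatrix}\nabla_w\mathcal{H}_d\\ \nabla_p\mathcal{H}_d\end{bmatrix},\qquad \mathcal{H}_d=\tfrac12p^\top M_w^{-1}p+\tfrac12w^\top Lw,$$ where $D_d=D_w+\hat D+\frac{k}{w_1^2}Q_w^\top e_1e_1^\top Q_w$.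
   Context: Setting. Let $n\ge 3$; all given functions below are smooth. A mechanical system has configuration $q\in\mathbb{R}^n$, canonical momentum $p_0\in\mathbb{R}^n$, mass matrix $M_0(q)=M_0^\top(q)>0$, potential energy $\mathcal{V}(q)>0$, damping matrix $D_0(p_0,q)=D_0^\top(p_0,q)\ge0$, input matrix $G_0(q)\in\mathbb{R}^{n\times2}$ and is subject to the non-integrable constraints $G_c^\top(q)\dot q=0$ with $G_c(q)\in\mathbb{R}^{n\times(n-2)}$ of full rank, where $[G_0(q)\ G_c(q)]$ is invertible. Let $Q(q)\in\mathbb{R}^{n\times 2}$ have rank 2 with $Q^\top G_c=0$. With reduced momentum $p=Q^\top p_0\in\mathbb{R}^2$ put $P(q,p)=M_0Q(Q^\top M_0Q)^{-1}p$ and $M=Q^\top M_0Q$, $D(q,p)=Q^\top D_0(P(q,p),q)Q$, $G=Q^\top G_0$ (an invertible $2\times2$ matrix), $C(q,p)=Q^\top\{(\frac{\partial P}{\partial q})^\top-\frac{\partial P}{\partial q}\}Q$ (Jacobian in $q$ at fixed $p$). The coordinates $z$. Assume there is a coordinate transformation (diffeomorphism) $z=f_z(q)$ of $\mathbb{R}^n$ with $f_z^{-1}(0_{n\times1})=0_{n\times 1}$ such that $Q_z(z)=\left[\frac{\partial f_z}{\partial q}Q\right]_{q=f_z^{-1}(z)}$ is smooth and the system has a chained structure, i.e. $Q_z$ has the left annihilator ($Q_z^\perp Q_z=0$) $$Q_z^\perp(z)=\begin{bmatrix}-z_2&0&1&0&\cdots&0\\ -z_3&0&0&1&\cdots&0\\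 \vdots&\vdots&\vdots&\vdots&\ddots&\vdots\\ -z_{n-1}&0&0&0&\cdots&1\end{bmatrix}\in\mathbb{R}^{(n-2)\times n}.$$ Let $M_z,C_z,D_z,G_z,\mathcal{V}_z$ denote $M,C,D,G,\mathcal{V}$ evaluated at $q=f_z^{-1}(z)$. The coordinates $w$. Define the smooth map $f_w^{-1}:w\mapsto z$ by $z_1=w_1$, $z_2=w_1w_2+\sum_{i=3}^n\frac{1}{(i-2)!}w_1^{i-2}w_i$, and $z_j=\sum_{i=3}^n\frac{1}{(i+j-4)!}w_1^{i+j-4}w_i$ for $3\le j\le n$. Restricted to $w_1\ne0$ it is a bijection onto $\{z_1\neq0\}$, with inverse $f_w$. For $w_1\neq 0$ set $Q_w(w)=\left[\frac{\partial f_w}{\partial z}Q_z\right]_{z=f_w^{-1}(w)}$, and let $M_w,C_w,D_w,G_w,\mathcal{V}_w$ denote $M_z,C_z,D_z,G_z,\mathcal{V}_z$ evaluated at $z=f_w^{-1}(w)$. $\nabla$ denotes the column gradient. *)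

(* Defs.v *)
From HB Require Import structures.
From mathcomp Require Export all_boot all_order all_algebra.
From mathcomp Require Export all_classical all_reals all_analysis.
Export Order.TTheory GRing.Theory Num.Theory.
Export numFieldNormedType.Exports.

#[export] Set Implicit Arguments.
#[export] Unset Strict Implicit.
#[export] Unset Printing Implicit Defensive.

Open Scope classical_set_scope.
Open Scope ring_scope.

(* Vectors are columns 'cV[R]_n; their coordinates x_1, ..., x_n are the
   entries x i 0 for i = 0, ..., n - 1.  A dimension n >= 3 is written m.+3. *)

Section Calculus.
Context {R : realType}.

Fixpoint Ck_on {V W : normedModType R} (k : nat) (U : set V) (f : V -> W)
    : Prop :=
  match k with
  | 0%N => forall x, U x -> {for x, continuous f}
  | k'.+1 => (forall x, U x -> differentiable f x) /\
             (forall v : V, Ck_on k' U (fun x => 'D_v f x))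
  end.

(* Meaningful for open U. *)
Definition smooth_on {V W : normedModType R} (U : set V) (f : V -> W) : Prop :=
  forall k, Ck_on k U f.

Definition smooth {V W : normedModType R} (f : V -> W) : Prop :=
  smooth_on setT f.

Definition grad {n : nat} (f : 'cV[R]_n -> R) (x : 'cV[R]_n) : 'cV[R]_n :=
  \col_i 'D_(delta_mx i 0) f x.

(* The library's 'J acts on row vectors (the transposed convention); here the
   (i, j) entry is the partial derivative of f_i with respect to x_j. *)
Definition jac {n k : nat} (f : 'cV[R]_n -> 'cV[R]_k) (x : 'cV[R]_n)
    : 'M[R]_(k, n) :=
  \matrix_(i, j) 'D_(delta_mx j 0) (fun y => f y i 0) x.

End Calculus.

Section Forms.
Context {R : realType} {n : nat}.

(* Symmetry is not part of these two predicates. *)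
Definition posdef (A : 'M[R]_n) : Prop :=
  forall x : 'cV[R]_n, x != 0 -> 0 < (x^T *m A *m x) 0 0.

Definition possemidef (A : 'M[R]_n) : Prop :=
  forall x : 'cV[R]_n, 0 <= (x^T *m A *m x) 0 0.

End Forms.

(* The constraints Gc(q)^T q' = 0 are integrable when, near every point, they
   amount to d/dt h(q) = 0, i.e. the rows of the Jacobian of h and those of
   Gc(q)^T span the same space. *)
Definition integrable_constraints {R : realType} {n k : nat}
    (Gc : 'cV[R]_n -> 'M[R]_(n, k)) : Prop :=
  forall q0 : 'cV[R]_n, exists (U : set 'cV[R]_n) (h : 'cV[R]_n -> 'cV[R]_k),
    [/\ open U, U q0, smooth_on U h &
        forall q, U q -> (jac h q == (Gc q)^T)%MS].

Section Reduction.
Context {R : realType} {n : nat}.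
Variables (M0 : 'cV[R]_n -> 'M[R]_n) (D0 : 'cV[R]_n -> 'cV[R]_n -> 'M[R]_n).
Variables (G0 Q : 'cV[R]_n -> 'M[R]_(n, 2)).

Definition redM (q : 'cV[R]_n) : 'M[R]_2 := (Q q)^T *m M0 q *m Q q.

Definition redP (q : 'cV[R]_n) (p : 'cV[R]_2) : 'cV[R]_n :=
  M0 q *m Q q *m invmx (redM q) *m p.

Definition redD (q : 'cV[R]_n) (p : 'cV[R]_2) : 'M[R]_2 :=
  (Q q)^T *m D0 (redP q p) q *m Q q.

Definition redG (q : 'cV[R]_n) : 'M[R]_2 := (Q q)^T *m G0 q.

Definition redC (q : 'cV[R]_n) (p : 'cV[R]_2) : 'M[R]_2 :=
  let J := jac (redP^~ p) q in (Q q)^T *m (J^T - J) *m Q q.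

End Reduction.

Section Coordinates.
Context {R : realType} {m : nat}.
Local Notation vec := 'cV[R]_m.+3.

(* The matrix Q transported by the change of coordinates f with inverse g. *)
Definition pushQ (f g : vec -> vec) (Q : vec -> 'M[R]_(m.+3, 2)) (y : vec)
    : 'M[R]_(m.+3, 2) :=
  jac f (g y) *m Q (g y).

Definition chained_annihilator (z : vec) : 'M[R]_(m.+1, m.+3) :=
  \matrix_(i, j) if j == 0 then - z (inord i.+1) 0 else (j == i.+2 :> nat)%:R.

(* The exponents i - 2 and i + j - 4 of 1-based indices become i - 1 and
   i + j - 2; no truncation occurs since 2 <= i. *)
Definition fw_inv (w : vec) : vec :=
  \col_j
    match val j with
    | 0%N => w 0 0
    | 1%N => w 0 0 * w (inord 1) 0 +
             \sum_(i < m.+3 | (2 <= i)%N)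
               ((i - 1)`!%N)%:R^-1 * w 0 0 ^+ (i - 1)%N * w i 0
    | _ => \sum_(i < m.+3 | (2 <= i)%N)
             ((i + j - 2)`!%N)%:R^-1 * w 0 0 ^+ (i + j - 2)%N * w i 0
    end.

(* fw_inv is injective on w_1 <> 0, with image z_1 <> 0; outside that image
   the value of fw is irrelevant. *)
Definition fw : vec -> vec :=
  'pinv_(fun=> 0) [set w : vec | w 0 0 != 0] fw_inv.

End Coordinates.

(* Main.v *)
Require Import Defs.
From mathcomp Require Import ring.

(* Since [G0 Gc] is invertible and Q has full rank with Q^T Gc = 0, the matrix
   G = Q^T G0 is invertible, so the control can cancel grad V_w and inject
   L w and the extra damping exactly.  The gradients of H_w and H_d are then
   compared termwise; because a directional derivative has an unspecified value
   where it does not exist, this requires the kinetic and potential energies to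
   be differentiable in w. *)

(** * Finite sums, products and powers of differentiable scalar functions *)

Section DifferentiableScalar.
Context {R : realType} {V : normedModType R}.
Implicit Type x : V.

Lemma differentiable_sum_fun (I : Type) (r : seq I) (P : pred I)
    (f : I -> V -> R) x :
  (forall i, differentiable (f i) x) ->
  differentiable (fun y => \sum_(i <- r | P i) f i y) x.
Proof.
move=> df; elim: r => [|i r IHr].
  under eq_fun do rewrite big_nil; exact: differentiable_cst.
under eq_fun do rewrite big_cons; case: (P i) => //.
exact: differentiableD.
Qed.

Lemma differentiable_prod_fun (I : Type) (r : seq I) (P : pred I)
    (f : I -> V -> R) x :
  (forall i, differentiable (f i) x) ->
  differentiable (fun y => \prod_(i <- r | P i) f i y) x.
Proof.
move=> df; elim: r => [|i r IHr].
  under eq_fun do rewrite big_nil; exact: differentiable_cst.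
under eq_fun do rewrite big_cons; case: (P i) => //.
exact: differentiableM.
Qed.

Lemma differentiable_exp_fun (f : V -> R) (n : nat) x :
  differentiable f x -> differentiable (fun y => f y ^+ n) x.
Proof.
move=> df; have -> : (fun y => f y ^+ n) = (fun y => \prod_(i < n) f y).
  by apply/funext => y; rewrite prodr_const card_ord.
exact: differentiable_prod_fun.
Qed.

End DifferentiableScalar.

(** * Differentiability of matrix-valued functions, up to the inverse *)

Section DifferentiableMatrix.
Context {R : realType} {V : normedModType R}.
Implicit Type x : V.

Lemma differentiable_entry (m n : nat) (A : V -> 'M[R]_(m, n)) x i j :
  differentiable A x -> differentiable (fun y => A y i j) x.
Proof.
move=> dA; apply: (@differentiable_comp _ _ _ _ A (fun B => B i j)) => //.
exact: differentiable_coord.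
Qed.

(** Expanding in the basis [delta_mx i j] leaves a finite sum of scalar functions times constant
    matrices. The matrix operations below are thereby reduced to their entries. *)
Lemma differentiable_mx (m n : nat) (A : V -> 'M[R]_(m, n)) x :
  (forall i j, differentiable (fun y => A y i j) x) -> differentiable A x.
Proof.
move=> dA.
have -> : A = \sum_(i < m) \sum_(j < n) (fun y => A y i j *: delta_mx i j).
  apply/funext => y; rewrite [LHS]matrix_sum_delta fct_sumE.
  by apply: eq_bigr => i _; rewrite fct_sumE.
by do 2 apply: differentiable_sum => ?; apply: differentiableZl.
Qed.

Lemma differentiable_trmx (m n : nat) (A : V -> 'M[R]_(m, n)) x :
  differentiable A x -> differentiable (fun y => (A y)^T) x.
Proof.
move=> dA; apply: differentiable_mx => i j.
by under eq_fun do rewrite mxE; exact: differentiable_entry.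
Qed.

Lemma differentiable_mulmx (m n p : nat) (A : V -> 'M[R]_(m, n))
    (B : V -> 'M[R]_(n, p)) x :
  differentiable A x -> differentiable B x ->
  differentiable (fun y => A y *m B y) x.
Proof.
move=> dA dB; apply: differentiable_mx => i j.
under eq_fun do rewrite mxE; apply: differentiable_sum_fun => k.
by apply: differentiableM; exact: differentiable_entry.
Qed.

Lemma differentiable_det (n : nat) (A : V -> 'M[R]_n) x :
  differentiable A x -> differentiable (fun y => \det (A y)) x.
Proof.
move=> dA; apply: differentiable_sum_fun => s.
apply: differentiableM; first exact: differentiable_cst.
by apply: differentiable_prod_fun => i; exact: differentiable_entry.
Qed.

Lemma differentiable_adj (n : nat) (A : V -> 'M[R]_n) x :
  differentiable A x -> differentiable (fun y => \adj (A y)) x.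
Proof.
move=> dA; apply: differentiable_mx => i j; under eq_fun do rewrite mxE.
apply: differentiableM; first exact: differentiable_cst.
apply/differentiable_det/differentiable_mx => a b.
by under eq_fun do rewrite !mxE; exact: differentiable_entry.
Qed.

(** By Cramer's rule the inverse is the adjugate divided by the determinant. Invertibility is
    assumed at every point so that the case distinction inside [invmx] is settled by an equality of
    functions. *)
Lemma differentiable_invmx (n : nat) (A : V -> 'M[R]_n) x :
  (forall y, A y \in unitmx) -> differentiable A x ->
  differentiable (fun y => invmx (A y)) x.
Proof.
move=> uA dA; under eq_fun do rewrite /invmx uA.
apply: differentiable_mx => i j; under eq_fun do rewrite mxE.
apply: differentiableM; last exact/differentiable_entry/differentiable_adj.
apply: differentiableV; first exact: differentiable_det.
by rewrite -unitfE -unitmxE.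
Qed.

End DifferentiableMatrix.

Lemma differentiable_smooth {R : realType} {V W : normedModType R}
    (f : V -> W) x : smooth f -> differentiable f x.
Proof. by move=> /(_ 1%N) [+ _]; apply. Qed.

(** * Gradients of sums and of diagonal quadratic forms *)

Section Gradient.
Context {R : realType} {n : nat}.
Implicit Types (f g : 'cV[R]_n -> R) (x : 'cV[R]_n).

Lemma gradD f g x : differentiable f x -> differentiable g x ->
  grad (fun y => f y + g y) x = grad f x + grad g x.
Proof.
move=> df dg; apply/colP => i; rewrite !mxE.
by apply: deriveD; exact: diff_derivable.
Qed.

(** The constant cancels in the difference quotient, so both sides are limits of the same function;
    this makes sense even where [f] has no derivative. *)
Lemma grad_addr f (c : R) x : grad (fun y => f y + c) x = grad f x.
Proof.
apply/colP => i; rewrite !mxE /derive.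
by under eq_fun do rewrite opprD addrACA subrr addr0.
Qed.

Lemma is_derive_coord (x v : 'cV[R]_n) i j :
  is_derive x v (fun y : 'cV[R]_n => y i j) (v i j).
Proof.
apply: DeriveDef; first exact/diff_derivable/differentiable_coord.
(* A coordinate function is an entry of the identity map, whose derivative along [v] is [v]. *)
have /matrixP/(_ i j) := derive_mx (@derivable_id R _ x v).
by rewrite derive_id mxE => ->.
Qed.

Lemma differentiable_diag_form (l : 'rV[R]_n) x :
  differentiable (fun y : 'cV[R]_n => 2^-1 * (y^T *m diag_mx l *m y) 0 0) x.
Proof.
apply: differentiableM; first exact: differentiable_cst.
apply/differentiable_entry/differentiable_mulmx => //.
apply: differentiable_mulmx; last exact: differentiable_cst.
exact: differentiable_trmx.
Qed.

Lemma grad_diag_form (l : 'rV[R]_n) x :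
  grad (fun y : 'cV[R]_n => 2^-1 * (y^T *m diag_mx l *m y) 0 0) x
  = diag_mx l *m x.
Proof.
apply/colP => i; rewrite mul_diag_mx !mxE.
(* Since the matrix is diagonal, the form is a weighted sum of squared coordinates, which is
   differentiated term by term. *)
have -> : (fun y : 'cV[R]_n => 2^-1 * (y^T *m diag_mx l *m y) 0 0) =
    \sum_(j < n) (2^-1 * l 0 j) *: ((fun y : 'cV[R]_n => y j 0) ^+ 2).
  apply/funext => y; rewrite mul_mx_diag mxE fct_sumE mulr_sumr.
  apply: eq_bigr => j _; rewrite !mxE.
  by rewrite expr2 -mulrA [in LHS](mulrCA (y j 0)); exact: mulrA.
have dq j := is_deriveZ (2^-1 * l 0 j)
  (is_deriveX 2 (is_derive_coord x (delta_mx i 0) j 0)).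
have [_ dsum] := is_derive_sum dq; rewrite [LHS]dsum.
(* Along the [i]-th basis vector only the square of the [i]-th coordinate varies; its factor 2
   cancels [2^-1]. *)
rewrite (bigD1 i) //= big1 ?addr0 => [|j /negPf ji]; rewrite !mxE ?eqxx ?ji /=.
  by rewrite expr1 /GRing.scale /= mulr1 mulrACA mulVf ?mul1r // pnatr_eq0.
by rewrite !scaler0.
Qed.

End Gradient.

(** If a row [v] is in the left kernel, the form [A] vanishes on the transpose of [v *m B^T].
    Positivity gives [v *m B^T = 0], and full rank of [B] gives [v = 0]. This makes the reduced mass
    matrix invertible. *)
Lemma posdef_congr_unitmx {R : realType} (n k : nat) (A : 'M[R]_n)
    (B : 'M[R]_(n, k)) :
  posdef A -> \rank B = k -> B^T *m A *m B \in unitmx.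
Proof.
move=> Apos rkB; rewrite -row_free_unit -kermx_eq0; apply/eqP/row_matrixP => i.
rewrite row0; set v := row i _.
have vK : v *m (B^T *m A *m B) = 0.
  by apply/sub_kermxP; exact: row_sub.
have Bfree : row_free B^T by rewrite /row_free mxrank_tr rkB.
apply/eqP; rewrite -(mulmx_free_eq0 _ Bfree).
apply/negPn/negP => vB.
have /Apos : (v *m B^T)^T != 0 by rewrite trmx_eq0.
rewrite trmxK trmx_mul trmxK.
have -> : v *m B^T *m A *m (B *m v^T) = v *m (B^T *m A *m B) *m v^T.
  by rewrite !mulmxA.
by rewrite vK mul0mx mxE ltxx.
Qed.

(** Multiplying [Q^T] by the row-free matrix [row_mx G Gc] keeps its rank [k], while the product is
    [row_mx (Q^T *m G) 0]; hence the square block [Q^T *m G] has full rank. *)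
Lemma annihilator_mul_unitmx {F : fieldType} (n k r : nat) (G : 'M[F]_(n, k))
    (Gc : 'M[F]_(n, r)) (Q : 'M[F]_(n, k)) :
  \rank (row_mx G Gc) = n -> \rank Q = k -> Q^T *m Gc = 0 ->
  Q^T *m G \in unitmx.
Proof.
move=> rkG rkQ QGc; rewrite -row_free_unit /row_free.
have GGc_free : row_free (row_mx G Gc) by rewrite /row_free rkG.
have := mxrankMfree Q^T GGc_free.
by rewrite mul_mx_row QGc rank_row_mx0 mxrank_tr rkQ => ->.
Qed.

(** Each coordinate of the map is a polynomial in the coordinates of [w]. *)
Lemma differentiable_fw_inv {R : realType} {m : nat} (w : 'cV[R]_m.+3) :
  differentiable (@fw_inv R m) w.
Proof.
have dc i j : differentiable (fun y : 'cV[R]_m.+3 => y i j) w.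
  exact: differentiable_coord.
have dterm (a : R) e i : differentiable
    (fun y : 'cV[R]_m.+3 => a * y 0 0 ^+ e * y i 0) w.
  apply: differentiableM => //; apply: differentiableM.
    exact: differentiable_cst.
  exact: differentiable_exp_fun.
apply: differentiable_mx => j i; under eq_fun do rewrite mxE.
case: (val j) => [//|[|e]]; last exact: differentiable_sum_fun.
apply: differentiableD; first exact: differentiableM.
exact: differentiable_sum_fun.
Qed.

Theorem proposition10 (R : realType) (m : nat)
  (M0 : 'cV[R]_m.+3 -> 'M[R]_m.+3)
  (V : 'cV[R]_m.+3 -> R)
  (D0 : 'cV[R]_m.+3 -> 'cV[R]_m.+3 -> 'M[R]_m.+3)
  (G0 Q : 'cV[R]_m.+3 -> 'M[R]_(m.+3, 2))
  (Gc : 'cV[R]_m.+3 -> 'M[R]_(m.+3, m.+1))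
  (fz fz_inv : 'cV[R]_m.+3 -> 'cV[R]_m.+3)
  (Dhat : 'M[R]_2) (k : R) (l : 'rV[R]_m.+3)
  (* the mechanical system *)
  (smooth_M0 : smooth M0) (smooth_V : smooth V)
  (smooth_D0 : smooth (fun x : 'cV[R]_m.+3 * 'cV[R]_m.+3 => D0 x.1 x.2))
  (smooth_G0 : smooth G0) (smooth_Gc : smooth Gc) (smooth_Q : smooth Q)
  (M0_sym : forall q, (M0 q)^T = M0 q) (M0_pos : forall q, posdef (M0 q))
  (V_pos : forall q, 0 < V q)
  (D0_sym : forall p0 q, (D0 p0 q)^T = D0 p0 q)
  (D0_pos : forall p0 q, possemidef (D0 p0 q))
  (Gc_rank : forall q, \rank (Gc q) = m.+1%N)
  (Gc_nonint : ~ integrable_constraints Gc)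
  (G0Gc_inv : forall q, (row_mx (G0 q) (Gc q) : 'M[R]_m.+3) \in unitmx)
  (Q_rank : forall q, \rank (Q q) = 2%N)
  (QGc : forall q, (Q q)^T *m Gc q = 0)
  (* the chained coordinates z *)
  (fzK : cancel fz fz_inv) (fz_invK : cancel fz_inv fz)
  (smooth_fz : smooth fz) (smooth_fz_inv : smooth fz_inv)
  (fz_inv0 : fz_inv 0 = 0)
  (smooth_Qz : smooth (pushQ fz fz_inv Q))
  (Qz_chained : forall z, chained_annihilator z *m pushQ fz fz_inv Q z = 0)
  (* the controller parameters *)
  (Dhat_pos : posdef Dhat) (k_pos : 0 < k) (l_pos : forall i, 0 < l 0 i) :
  let Qz := pushQ fz fz_inv Q in
  let Mz z := redM M0 Q (fz_inv z) in
  let Cz z p := redC M0 Q (fz_inv z) p in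
  let Dz z p := redD M0 D0 Q (fz_inv z) p in
  let Gz z := redG G0 Q (fz_inv z) in
  let Vz z := V (fz_inv z) in
  let Qw := pushQ fw fw_inv Qz in
  let Mw w := Mz (fw_inv w) in
  let Cw w p := Cz (fw_inv w) p in
  let Dw w p := Dz (fw_inv w) p in
  let Gw w := Gz (fw_inv w) in
  let Vw w := Vz (fw_inv w) in
  let e1 : 'cV[R]_m.+3 := delta_mx 0 0 in
  let L := diag_mx l in
  let Hw (w : 'cV[R]_m.+3) (p : 'cV[R]_2) : R :=
    2^-1 * (p^T *m invmx (Mw w) *m p) 0 0 + Vw w in
  let Hd (w : 'cV[R]_m.+3) (p : 'cV[R]_2) : R :=
    2^-1 * (p^T *m invmx (Mw w) *m p) 0 0 + 2^-1 * (w^T *m L *m w) 0 0 in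
  let Damp (w : 'cV[R]_m.+3) : 'M[R]_2 :=
    Dhat + (k / w 0 0 ^+ 2) *: ((Qw w)^T *m e1 *m e1^T *m Qw w) in
  let Dd w p := Dw w p + Damp w in
  let system (w : 'cV[R]_m.+3) (p u : 'cV[R]_2) : 'cV[R]_(m.+3 + 2) :=
    block_mx 0 (Qw w) (- (Qw w)^T) (Cw w p - Dw w p)
      *m col_mx (grad (Hw^~ p) w) (grad (Hw w) p)
    + col_mx (0 : 'M[R]_(m.+3, 2)) (Gw w) *m u in
  let control (w : 'cV[R]_m.+3) (p : 'cV[R]_2) : 'cV[R]_2 :=
    - (invmx (Gw w) *m ((Qw w)^T *m (L *m w - grad Vw w)
                        + Damp w *m grad (Hw w) p)) in
  forall (w : 'cV[R]_m.+3) (p : 'cV[R]_2), w 0 0 != 0 ->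
    system w p (control w p) =
    block_mx 0 (Qw w) (- (Qw w)^T) (Cw w p - Dd w p)
      *m col_mx (grad (Hd^~ p) w) (grad (Hd w) p).
Proof.
move=> Qz Mz Cz Dz Gz Vz Qw Mw Cw Dw Gw Vw e1 L Hw Hd Damp Dd system control.
move=> w p w0; rewrite /system /control {system control}.
have Gw_unit : Gw w \in unitmx.
  rewrite /Gw /Gz /redG; set q := fz_inv _.
  apply: (@annihilator_mul_unitmx _ _ _ _ _ (Gc q)) => //.
  exact: mxrank_unit.
have dq : differentiable (fun y => fz_inv (fw_inv y)) w.
  apply: (@differentiable_comp _ _ _ _ (@fw_inv R m) fz_inv).
    exact: differentiable_fw_inv.
  exact: differentiable_smooth.
(* The energies depend on [w] only through smooth data evaluated at [q], hence through this
   composite. *)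
have dcomp (W : normedModType R) (f : 'cV[R]_m.+3 -> W) : smooth f ->
    differentiable (fun y => f (fz_inv (fw_inv y))) w.
  move=> sf; apply: (differentiable_comp dq); exact: differentiable_smooth.
have dV : differentiable Vw w by exact: dcomp.
(* The kinetic energy at fixed [p], common to [Hw] and [Hd]. *)
pose T (y : 'cV[R]_m.+3) := 2^-1 * (p^T *m invmx (Mw y) *m p) 0 0.
have dT : differentiable T w.
  apply: differentiableM; first exact: differentiable_cst.
  apply: differentiable_entry.
  apply: differentiable_mulmx; last exact: differentiable_cst.
  apply: differentiable_mulmx; first exact: differentiable_cst.
  apply: differentiable_invmx => [y|]; first exact: posdef_congr_unitmx.
  apply: differentiable_mulmx; last exact: dcomp.
  apply: differentiable_mulmx; last exact: dcomp.
  exact/differentiable_trmx/dcomp.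
have -> : grad (Hw^~ p) w = grad T w + grad Vw w by exact: gradD.
have -> : grad (Hd^~ p) w = grad T w + L *m w.
  rewrite -grad_diag_form; apply: gradD => //.
  exact: differentiable_diag_form.
(* At fixed [w] the two potential terms are constants in [p]. *)
have -> : grad (Hd w) p = grad (Hw w) p by rewrite !grad_addr.
move: (grad (Hw w) p) => g.
rewrite !mul_block_col mul_col_mx add_col_mx !mul0mx !add0r addr0.
(* The upper blocks agree already. In the lower one [Gw w] cancels its inverse in the control. *)
congr col_mx; rewrite mulmxN mulmxA mulmxV // mul1mx /Dd.
rewrite !(mulmxBl, mulmxDl _ _ g) !mulmxDr mulmxN !mulNmx.
(* With all products made opaque, what remains is additive: the two [b] terms cancel, and [c] and
   [h] enter with a minus sign on both sides. *)
move: (_ *m grad T w) (_ *m grad Vw w) (_ *m (L *m w)) => a b c.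
move: (Cw w p *m g) (Dw w p *m g) (Damp w *m g) => c' d' h.
by apply/colP => i; rewrite !mxE; ring.
Qed.
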